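(* Let $F^2=BJ^2$ be the pseudo-Finsleroid metric function (defined in the context) with $a^{ij}b_ib_j=-c^2$, $0<c\le1$. In the time-like sector ($\epsilon=1$) and in the space-like sector ($\epsilon=-1$), at every $(x,y)$ with $\nu\ne0$ and $C_hC^h\neq0$, the Cartan tensor $C_{ijk}=\frac12\frac{\partial g_{ij}}{\partial y^k}$ is of the form $$C_{ijk}=X\Bigl[C_ih_{jk}+C_jh_{ik}+C_kh_{ij}-\Bigl(N+1-\frac1X\Bigr)\frac{1}{C_hC^h}\,C_iC_jC_k\Bigr],$$ where $$\frac1X=N+\epsilon\,\frac{(1-c^2)B}{q\,\nu},\qquad \nu=q-\epsilon(1-c^2)g\,b .$$
   Context: Let $M$ be an $N$-dimensional smooth manifold with a pseudo-Riemannian metric tensor $a_{ij}(x)$ of signature $(+,-,\dots,-)$ and inverse $a^{ij}$, a 1-form $b_i(x)$ with $a^{ij}b_ib_j=-c(x)^2$, $0<c(x)\le1$, and a scalar field $g(x)$. For $y\in T_xM$ put $$b=b_i(x)y^i,\quad r_{ij}=a_{ij}+b_ib_j,\quad \gamma=r_{ij}y^iy^j,\quad q=\sqrt{|\gamma|},\quad B=\gamma-g\,b\,q-b^2 .$$ Time-like sector ($\epsilon=1$, any real $g$): the $y$ with $\gamma>0$ and $B>0$. There $h=\sqrt{1+g^2/4}$, $G=g/h$, $g_\pm=-\frac12g\pm h$, $B=(b-g_-q)(g_+q-b)$ and $J=\left(\frac{b-g_-q}{g_+q-b}\right)^{-G/4}$. Space-like sector ($\epsilon=-1$, $-2<g<2$):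 the $y$ with $\gamma<0$ (so $B=-(q^2+gbq+b^2)<0$). There $h=\sqrt{1-g^2/4}$, $G=g/h$, $L=q+\frac g2 b$, $J=e^{-\frac12 G f}$ with $f=-\arctan\frac G2+\arctan\frac{L}{hb}$ if $b<0$, $f=-\pi-\arctan\frac G2+\arctan\frac{L}{hb}$ if $b>0$ and, by continuity, $f=-\frac\pi2-\arctan\frac G2$ if $b=0$. In both sectors $F^2=BJ^2$, $y_i=\frac12\frac{\partial F^2}{\partial y^i}$, $g_{ij}=\frac12\frac{\partial^2F^2}{\partial y^i\partial y^j}$, $(g^{ij})$ is the inverse of $(g_{ij})$, $h_{ij}=g_{ij}-\frac1{F^2}y_iy_j$, $C_i=\frac{\partial}{\partial y^i}\ln\sqrt{|\det(g_{mn})|}$, $C^i=g^{ij}C_j$. *)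

(* Defs.v *)
From HB Require Import structures.
From mathcomp Require Import all_boot all_order all_algebra.
From mathcomp Require Import all_classical all_reals all_analysis.

Set Implicit Arguments.
Unset Strict Implicit.
Unset Printing Implicit Defensive.

Import Order.TTheory GRing.Theory Num.Theory.
Import numFieldNormedType.Exports.

Local Open Scope ring_scope.

(* Everything below lives in a single tangent space T_xM, identified with
   'rV[R]_N by the coordinates y^i of a local chart: [a] is the matrix a_ij(x),
   [b] the row of components b_i(x), [g] the scalar g(x). All derivatives are
   taken in y with x fixed. *)

Definition has_signature_1_minus (R : realType) (N : nat) (a : 'M[R]_N) : Prop :=
  exists2 P : 'M[R]_N, P \in unitmx &
    a = P^T *m diag_mx (\row_(i < N) (if i == 0%N :> nat then 1 else -1)) *m P.

Definition partial (R : realType) (N : nat) (i : 'I_N) (f : 'rV[R]_N -> R)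
  (y : 'rV[R]_N) : R := 'D_(delta_mx 0 i) f y.

Inductive sector := TimeLike | SpaceLike.

Section PseudoFinsleroid.
Variables (R : realType) (N : nat) (s : sector).
Variables (a : 'M[R]_N) (b : 'rV[R]_N) (g : R).
Implicit Types (y : 'rV[R]_N) (i j k : 'I_N).

Definition eps : R := if s is TimeLike then 1 else -1.

Definition form_b y : R := \sum_i b 0 i * y 0 i.

Definition tensor_r : 'M[R]_N := \matrix_(i, j) (a i j + b 0 i * b 0 j).

Definition gamma y : R := \sum_i \sum_j tensor_r i j * y 0 i * y 0 j.

Definition q y : R := Num.sqrt `|gamma y|.

Definition B y : R := gamma y - g * form_b y * q y - form_b y ^+ 2.

Definition in_sector y : Prop :=
  match s with
  | TimeLike => 0 < gamma y /\ 0 < B y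
  | SpaceLike => -2 < g < 2 /\ gamma y < 0
  end.

Definition h : R := Num.sqrt (1 + eps * (g ^+ 2 / 4)).

Definition G : R := g / h.

Definition g_plus : R := - (1 / 2) * g + h.
Definition g_minus : R := - (1 / 2) * g - h.

Definition L y : R := q y + g / 2 * form_b y.

Definition f y : R :=
  if form_b y < 0 then - atan (G / 2) + atan (L y / (h * form_b y))
  else if 0 < form_b y then
    - pi - atan (G / 2) + atan (L y / (h * form_b y))
  else - (pi / 2) - atan (G / 2).

Definition J y : R :=
  match s with
  | TimeLike =>
      ((form_b y - g_minus * q y) / (g_plus * q y - form_b y)) `^ (- (G / 4))
  | SpaceLike => expR (- (1 / 2) * G * f y)
  end.

(* F^2 itself; it is negative in the space-like sector. *)
Definition F2 y : R := B y * J y ^+ 2.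

Definition y_low y i : R := 1 / 2 * partial i F2 y.

Definition g_low y : 'M[R]_N :=
  \matrix_(i, j) (1 / 2 * partial i (partial j F2) y).

Definition g_up y : 'M[R]_N := invmx (g_low y).

Definition h_low y i j : R := g_low y i j - 1 / F2 y * y_low y i * y_low y j.

Definition C_low y i : R :=
  partial i (fun z => ln (Num.sqrt `|\det (g_low z)|)) y.

Definition C_up y i : R := \sum_j g_up y i j * C_low y j.

Definition C_sq y : R := \sum_i C_low y i * C_up y i.

Definition cartan y i j k : R := 1 / 2 * partial k (fun z => g_low z i j) y.

Definition nu (c : R) y : R := q y - eps * (1 - c ^+ 2) * g * form_b y.

End PseudoFinsleroid.

(* Main.v *)
Require Import Defs.
From HB Require Import structures.
From mathcomp Require Import all_boot all_order all_algebra.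
From mathcomp Require Import ring lra.
From mathcomp Require Import all_classical all_reals all_analysis.

Import Order.TTheory GRing.Theory Num.Theory.
Import numFieldNormedType.Exports.

Local Open Scope ring_scope.

(** In both sectors the conformal factor [K = J ^ 2] satisfies
    [dK = K p w] with [p = g eps / (q B)] and [w_i = b u_i - gamma b_i], where
    [u_i = r_ij y^j]; this is the only place where the shape of [J] matters.
    Hence [y_i = K (u_i - (b + g q) b_i)], and [g_ij] is [K] times [a_ij] plus a
    rank-two term in [u] and [b]. The matrix determinant lemma gives
    [det g = K ^ N (det a) nu / q], whose logarithmic derivative is
    [C_i = (p / 2) (N + eps (1 - c ^ 2) B / (q nu)) w_i]. One more
    differentiation gives
    [C_ijk = (p / 2) (w_i h_jk + w_j h_ik + w_k h_ij + D w_i w_j w_k)] with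
    [D = eps K / (q ^ 2 B)], and replacing [w] by [C] yields the claim once
    [w_i w^i] is known; for that the system [g_ij w^j = w_i] is solved in the
    span of [b^i] and [y^i]. *)

Set Implicit Arguments.
Unset Strict Implicit.
Unset Printing Implicit Defensive.

(** * Restriction to lines, and auxiliary analytic facts *)

(** The two difference quotients are the same function, so one-variable calculus applies along each
    line. *)
Lemma is_derive_line (R : realType) (V : normedModType R) (f : V -> R)
    (x v : V) (df : R) :
  is_derive x v f df <-> is_derive (0 : R) 1 (fun t => f (t *: v + x)) df.
Proof.
have E : (fun h : R => h^-1 *: (((fun t : R => f (t *: v + x)) \o shift 0)
             (h *: (1 : R)) - f (0 *: v + x))) =
         (fun h => h^-1 *: ((f \o shift x) (h *: v) - f x)).
  by apply/funext => t; rewrite /= scale0r add0r addr0 [t *: 1]mulr1.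
split=> -[df1 df2]; constructor.
- by rewrite /derivable E.
- by rewrite /derive E.
- by move: df1; rewrite /derivable E.
- by move: df2; rewrite /derive E.
Qed.

(** On the line through [x] along [v] this is the one-variable chain rule; the inner function only
    has to be differentiable in that direction. *)
Lemma is_derive_comp1 (R : realType) (V : normedModType R) (f : R -> R)
    (g : V -> R) (x v : V) (df dg : R) :
  is_derive (g x) 1 f df -> is_derive x v g dg ->
  is_derive x v (fun z => f (g z)) (df * dg).
Proof.
move=> hf /is_derive_line hg; apply/is_derive_line.
by apply: (@is_derive1_comp _ f (fun t => g (t *: v + x))) => //; rewrite scale0r add0r.
Qed.

(** For positive [x] the angle [pi / 2 - atan x] stays in the interval where [atan] inverts [tan].
    This serves to join the branches of [f]. *)
Lemma atanV (R : realType) (x : R) : 0 < x -> atan x^-1 = pi / 2 - atan x.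
Proof.
move=> x0.
have a0 : 0 < atan x by rewrite -(@atan0 R) lt_atan.
have a1 := atan_ltpi2 x.
have -> : x^-1 = tan (pi / 2 - atan x).
  rewrite /tan sinB cosB sin_pihalf cos_pihalf !mul1r !mul0r subr0 add0r.
  by rewrite -[RHS]invf_div -/(tan _) atanK.
by apply: tanK; rewrite in_itv /=; apply/andP; split; lra.
Qed.

Lemma continuous_bigsum (R : realType) (V : normedModType R) (I : finType)
    (f : I -> V -> R) :
  (forall i, continuous (f i)) -> continuous (fun z => \sum_i f i z).
Proof.
move=> cf; elim: (index_enum I) => [|i l IH] z.
  by under eq_fun do rewrite big_nil; exact: cvg_cst.
under eq_fun do rewrite big_cons.
by apply: cvgD; [exact: cf | exact: IH].
Qed.

(** * Calculus rules for scalar functions along a direction *)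

Section DirectionalDerivative.
Variables (R : realType) (V : normedModType R).
Implicit Types (f : V -> R) (x v : V).

Lemma is_derive_val f x v df : is_derive x v f df -> 'D_v f x = df.
Proof. by case. Qed.

Lemma is_derive_expR_comp f x v df : is_derive x v f df ->
  is_derive x v (fun z => expR (f z)) (expR (f x) * df).
Proof. by move=> hf; apply: is_derive_comp1. Qed.

Lemma is_derive_ln_comp f x v df : is_derive x v f df -> 0 < f x ->
  is_derive x v (fun z => ln (f z)) (df / f x).
Proof.
move=> hf f0; rewrite mulrC; apply: (@is_derive_comp1 _ _ (@ln R)) => //.
exact: is_derive1_ln.
Qed.

Lemma is_derive_atan_comp f x v df : is_derive x v f df ->
  is_derive x v (fun z => atan (f z)) (df / (1 + f x ^+ 2)).
Proof. by move=> hf; rewrite mulrC; apply: (@is_derive_comp1 _ _ (@atan R)). Qed.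

Lemma is_derive_inv_comp f x v df : is_derive x v f df -> f x != 0 ->
  is_derive x v (fun z => (f z)^-1) (- df / f x ^+ 2).
Proof.
move=> hf f0.
have -> : - df / f x ^+ 2 = - f x ^- 2 * df by rewrite mulNr mulrC mulNr.
apply: (@is_derive_comp1 _ _ (@GRing.inv R)) => //.
have := @is_deriveV _ id (f x) 1 1 f0 (is_derive_id _ _).
by rewrite /= [- _ *: _]mulr1.
Qed.

Lemma is_derive_div_comp f f' x v df df' :
  is_derive x v f df -> is_derive x v f' df' -> f' x != 0 ->
  is_derive x v (fun z => f z / f' z) ((df * f' x - f x * df') / f' x ^+ 2).
Proof.
move=> hf hf' f0.
have := is_deriveM hf (is_derive_inv_comp hf' f0).
move=> h; apply: (is_derive_eq h); rewrite /GRing.scale /=; field.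
exact: f0.
Qed.

Lemma is_derive_mul_comp f f' x v df df' :
  is_derive x v f df -> is_derive x v f' df' ->
  is_derive x v (fun z => f z * f' z) (df * f' x + f x * df').
Proof.
move=> hf hf'; apply: (is_derive_eq (is_deriveM hf hf')).
by rewrite /GRing.scale /=; ring.
Qed.

Lemma is_derive_cstD (k : R) f x v df : is_derive x v f df ->
  is_derive x v (fun z => k + f z) df.
Proof.
move=> hf; apply: (is_derive_eq (is_deriveD (is_derive_cst k x v) hf)).
by rewrite add0r.
Qed.

Lemma is_derive_cstM (k : R) f x v df : is_derive x v f df ->
  is_derive x v (fun z => k * f z) (k * df).
Proof. exact: is_deriveZ. Qed.

Lemma is_derive_add f f' x v df df' :
  is_derive x v f df -> is_derive x v f' df' ->
  is_derive x v (fun z => f z + f' z) (df + df').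
Proof. exact: is_deriveD. Qed.

Lemma is_derive_sub f f' x v df df' :
  is_derive x v f df -> is_derive x v f' df' ->
  is_derive x v (fun z => f z - f' z) (df - df').
Proof. exact: is_deriveB. Qed.

Lemma is_derive_opp f x v df :
  is_derive x v f df -> is_derive x v (fun z => - f z) (- df).
Proof. exact: is_deriveN. Qed.

Lemma is_derive_sqr_comp f x v df : is_derive x v f df ->
  is_derive x v (fun z => f z ^+ 2) (2 * f x * df).
Proof.
move=> hf; apply: (is_derive_eq (is_derive_mul_comp hf hf)); ring.
Qed.

(** Here [e] is the sign of [f x]: near that value [|t| = e t], so the outer function is
    [sqrt (e t)]. Keeping [e] as a parameter treats both sectors at once. *)
Lemma is_derive_sqrt_abs f x v df (e : R) : e ^+ 2 = 1 -> 0 < e * f x ->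
  is_derive x v f df ->
  is_derive x v (fun z => Num.sqrt `|f z|) (e * df / (2 * Num.sqrt `|f x|)).
Proof.
move=> e2 f0 hf.
have ene : e = 1 \/ e = -1.
  have /eqP : e ^+ 2 - 1 = 0 by rewrite e2 subrr.
  rewrite subr_sqr_1 mulf_eq0 => /orP[/eqP|/eqP] ?; [left|right]; lra.
have ab : `|f x| = e * f x.
  by case: ene f0 => -> f0; [rewrite gtr0_norm; lra | rewrite ltr0_norm; lra].
have h1 : is_derive (f x) 1 (fun t : R => Num.sqrt `|t|) (e / (2 * Num.sqrt `|f x|)).
  apply: (@near_eq_is_derive _ _ _ (fun t : R => Num.sqrt (e * t))).
    case: ene f0 => -> f0.
      have /lt_nbhsr H : 0 < f x by lra.
      near=> t; have ht : 0 < t by near: t.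
      by rewrite mul1r gtr0_norm.
    have /lt_nbhsl H : f x < 0 by lra.
    near=> t; have ht : t < 0 by near: t.
    by rewrite mulN1r ltr0_norm.
  rewrite mulrC ab; apply: (@is_derive_comp1 _ _ (@Num.sqrt R) (fun t => e * t)).
    exact: is_derive1_sqrt.
  have := is_deriveZ e (is_derive_id (f x) (1 : R)).
  by rewrite [e *: 1]mulr1.
apply: is_derive_eq; first exact: (is_derive_comp1 h1 hf).
by rewrite mulrAC.
Unshelve. all: by end_near. Qed.

End DirectionalDerivative.

(** * Determinants of rank-two perturbations *)

(** Sylvester's identity: one block matrix is factored into block triangular matrices in two ways,
    each leaving one of the two determinants. *)
Lemma det_1pMC (K : comNzRingType) m n (A : 'M[K]_(m, n)) (B : 'M[K]_(n, m)) :
  \det (1%:M + A *m B) = \det (1%:M + B *m A).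
Proof.
have E1 : block_mx 1%:M (- A) B 1%:M =
    block_mx 1%:M 0 B 1%:M *m block_mx 1%:M (- A) 0 (1%:M + B *m A).
  by rewrite mulmx_block !mul1mx ?mulmx1 !mul0mx !addr0 mulmxN addrCA addNr addr0.
have E2 : block_mx 1%:M (- A) B 1%:M =
    block_mx (1%:M + A *m B) (- A) 0 1%:M *m block_mx 1%:M 0 B 1%:M.
  by rewrite mulmx_block !mul1mx !mulmx1 !mul0mx ?mulmx0 !add0r mulNmx addrK.
move: (congr1 determinant E1); rewrite {1}E2 !det_mulmx !det_ublock !det_lblock.
by rewrite !det1 !mul1r !mulr1.
Qed.

Lemma det_mx22 (K : comNzRingType) (A : 'M[K]_2) :
  \det A = A 0 0 * A 1 1 - A 0 1 * A 1 0.
Proof.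
rewrite (expand_det_row _ 0) !big_ord_recl big_ord0 addr0 /cofactor !det_mx11 !mxE /=.
have -> : lift ord0 (0 : 'I_1) = 1 :> 'I_2 by apply/val_inj.
have -> : lift (1 : 'I_2) (0 : 'I_1) = 0 by apply/val_inj.
by rewrite /bump /= addn0 expr0 expr1; ring.
Qed.

Lemma det_block_mx11 (K : comNzRingType) (A B C D : 'M[K]_1) :
  \det (block_mx A B C D) = A 0 0 * D 0 0 - B 0 0 * C 0 0.
Proof.
rewrite det_mx22.
set M := block_mx A B C D.
have -> : M 0 0 = A 0 0.
  by rewrite -(block_mxEul A B C D); congr (M _ _); apply/val_inj.
have -> : M 0 1 = B 0 0.
  by rewrite -(block_mxEur A B C D); congr (M _ _); apply/val_inj.
have -> : M 1 0 = C 0 0.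
  by rewrite -(block_mxEdl A B C D); congr (M _ _); apply/val_inj.
by rewrite -(block_mxEdr A B C D); congr (_ * M _ _ - _); apply/val_inj.
Qed.

(** The columns are given as [a *m x] and [a *m t], so [a] factors out without being inverted;
    Sylvester's identity then leaves a 2 by 2 determinant. *)
Lemma det_add_rank2 (K : comNzRingType) n (a : 'M[K]_n) (x t : 'cV[K]_n)
    (u v : 'rV[K]_n) :
  \det (a + (a *m x *m u + a *m t *m v)) =
  \det a * ((1 + (u *m x) 0 0) * (1 + (v *m t) 0 0) - (u *m t) 0 0 * (v *m x) 0 0).
Proof.
have -> : a + (a *m x *m u + a *m t *m v) =
    a *m (1%:M + row_mx x t *m col_mx u v).
  by rewrite mulmxDr mulmx1 mul_row_col mulmxDr !mulmxA.
rewrite det_mulmx det_1pMC mul_col_row; congr (_ * _).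
rewrite (@scalar_mx_block _ 1 1) add_block_mx !add0r det_block_mx11.
by rewrite ![(_%:M + _) _ _]mxE ![1%:M _ _]mxE.
Qed.

(** * Logarithmic derivatives *)

(** Stated through [df / f x], which avoids the exponent [n - 1] and lets [f x ^+ n] be treated as a
    single atom. *)
Lemma is_derive_pow_comp (R : realType) (V : normedModType R) (f : V -> R) x v df n :
  is_derive x v f df -> f x != 0 ->
  is_derive x v (fun z => f z ^+ n) (n%:R * (df / f x) * f x ^+ n).
Proof.
move=> hf f0; elim: n => [|n IH].
  by rewrite !mul0r; exact: is_derive_cst.
have -> : (fun z => f z ^+ n.+1) = (fun z => f z * f z ^+ n).
  by apply/funext => z; rewrite exprS.
apply: (is_derive_eq (is_derive_mul_comp hf IH)).
by rewrite exprS -natr1; field.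
Qed.

Lemma is_derive_ln_sqrt_abs (R : realType) (V : normedModType R) (f : V -> R) x v df :
  is_derive x v f df -> f x != 0 ->
  is_derive x v (fun z => ln (Num.sqrt `|f z|)) (df / (2 * f x)).
Proof.
move=> hf f0; pose e : R := Num.sg (f x).
have e2 : e ^+ 2 = 1 by rewrite sqr_sg f0.
have ef : e * f x = `|f x| by rewrite normrEsg.
have s0 : 0 < Num.sqrt `|f x| by rewrite sqrtr_gt0 normr_gt0.
have f1 : 0 < e * f x by rewrite ef normr_gt0.
have h := is_derive_ln_comp (is_derive_sqrt_abs e2 f1 hf) s0.
apply: (is_derive_eq h).
have ss : Num.sqrt `|f x| ^+ 2 = e * f x by rewrite sqr_sqrtr // ef.
have -> : e * df / (2 * Num.sqrt `|f x|) / Num.sqrt `|f x| =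
    e * df / (2 * Num.sqrt `|f x| ^+ 2) by field; rewrite gt_eqF.
rewrite ss; field; rewrite f0 /=.
by apply/negP => /eqP e0; move: f1; rewrite e0 mul0r ltxx.
Qed.

(** * The linear and quadratic forms in [y] and their derivatives *)

Section CartanTensor.
Variables (R : realType) (N : nat) (s : sector).
Variables (a : 'M[R]_N) (b : 'rV[R]_N) (g : R).
Hypothesis a_sym : a^T = a.
Implicit Types (z v : 'rV[R]_N).

Local Notation e := (eps R s).
Local Notation beta := (form_b b).
Local Notation r := (tensor_r a b).
Local Notation gam := (gamma a b).
Local Notation qq := (q a b).
Local Notation BB := (B a b g).
Local Notation sect := (in_sector s a b g).
Local Notation hh := (h s g).

Definition u_low z i : R := \sum_j r i j * z 0 j.

(** The symmetric bilinear form that polarises [gamma]. *)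
Definition pairing z v : R := \sum_i u_low z i * v 0 i.

(* The conformal factor [K]. *)
Definition conf z : R := J s a b g z ^+ 2.

Lemma tensor_rC i j : r i j = r j i.
Proof. by rewrite !mxE -{1}a_sym mxE [b 0 i * _]mulrC. Qed.

Lemma pairingC z v : pairing z v = pairing v z.
Proof.
rewrite /pairing /u_low.
under eq_bigr => i _ do rewrite mulr_suml.
under [RHS]eq_bigr => i _ do rewrite mulr_suml.
rewrite exchange_big; apply: eq_bigr => i _; apply: eq_bigr => j _.
by rewrite tensor_rC mulrAC.
Qed.

Lemma gammaE z : gam z = pairing z z.
Proof.
rewrite /pairing /u_low /gamma; apply: eq_bigr => i _; rewrite mulr_suml.
by apply: eq_bigr => j _; rewrite mulrAC.
Qed.

Lemma form_b_delta i : beta (delta_mx 0 i) = b 0 i.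
Proof.
rewrite /form_b (bigD1 i) //= big1 ?addr0 ?mxE ?eqxx ?mulr1 // => j ji.
by rewrite mxE (negbTE ji) andbF mulr0.
Qed.

Lemma u_low_delta i k : u_low (delta_mx 0 k) i = r i k.
Proof.
rewrite /u_low (bigD1 k) //= big1 ?addr0 ?[delta_mx _ _ _ _]mxE ?eqxx ?mulr1 // => j ji.
by rewrite [delta_mx _ _ _ _]mxE (negbTE ji) andbF mulr0.
Qed.

Lemma pairing_delta z i : pairing z (delta_mx 0 i) = u_low z i.
Proof.
rewrite /pairing (bigD1 i) //= big1 ?addr0 ?mxE ?eqxx ?mulr1 // => j ji.
by rewrite mxE (negbTE ji) andbF mulr0.
Qed.

Lemma form_bDZ (t : R) z v : beta (t *: v + z) = t * beta v + beta z.
Proof.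
rewrite /form_b mulr_sumr -big_split /=; apply: eq_bigr => i _.
by rewrite !mxE; ring.
Qed.

Lemma u_lowDZ (t : R) z v i : u_low (t *: v + z) i = t * u_low v i + u_low z i.
Proof.
rewrite /u_low mulr_sumr -big_split /=; apply: eq_bigr => j _.
have -> : (t *: v + z) 0 j = t * v 0 j + z 0 j by rewrite !mxE.
by ring.
Qed.

Lemma is_derive_affine z v (f : 'rV[R]_N -> R) df :
  (forall t : R, f (t *: v + z) = t * df + f z) -> is_derive z v f df.
Proof.
move=> H; apply/is_derive_line.
rewrite (_ : (fun t : R => _) = (fun t : R => t * df + f z)); last exact/funext.
have h := is_derive_mul_comp (is_derive_id (0 : R) 1) (is_derive_cst df (0 : R) 1).
apply: (is_derive_eq (is_deriveD h (is_derive_cst (f z) (0 : R) 1))).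
by rewrite /= mulr0 !addr0 mul1r.
Qed.

Lemma is_derive_form_b z v : is_derive z v beta (beta v).
Proof. by apply: is_derive_affine => t; exact: form_bDZ. Qed.

Lemma is_derive_u_low z v i : is_derive z v (u_low^~ i) (u_low v i).
Proof. by apply: is_derive_affine => t; exact: u_lowDZ. Qed.

Lemma is_derive_gamma z v : is_derive z v gam (2 * pairing z v).
Proof.
have -> : gam = \sum_i (fun x => u_low x i * x 0 i).
  by apply/funext => x; rewrite gammaE /pairing fct_sumE.
have H i : is_derive z v (fun x : 'rV[R]_N => u_low x i * x 0 i)
    (u_low v i * z 0 i + u_low z i * v 0 i).
  apply: is_derive_mul_comp; first exact: is_derive_u_low.
  by apply: is_derive_affine => t; rewrite !mxE.
apply: (is_derive_eq (is_derive_sum H)).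
by rewrite big_split /= -!/(pairing _ _) pairingC; ring.
Qed.

(** * Openness of the sectors, signs and nonvanishing *)

Lemma form_b_continuous : continuous beta.
Proof.
apply: continuous_bigsum => i z.
by apply: continuousM; [exact: cst_continuous | exact: coord_continuous].
Qed.

Lemma gamma_continuous : continuous gam.
Proof.
apply: continuous_bigsum => i; apply: continuous_bigsum => j z.
apply: (@continuousM _ _ (fun x : 'rV_N => r i j * x 0 i) (fun x => x 0 j));
  last exact: coord_continuous.
apply: (@continuousM _ _ (fun=> r i j) (fun x : 'rV_N => x 0 i)).
  exact: cst_continuous.
exact: coord_continuous.
Qed.

Lemma q_continuous : continuous qq.
Proof.
move=> z; apply: (@continuous_comp _ _ _ gam (fun t : R => Num.sqrt `|t|)).
  exact: gamma_continuous.
apply: (@continuous_comp _ _ _ (fun t : R => `|t|) (@Num.sqrt R)).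
  exact: norm_continuous.
exact: sqrt_continuous.
Qed.

Lemma B_continuous : continuous BB.
Proof.
move=> z.
apply: (@continuousB _ _ _ (fun x => gam x - g * beta x * qq x)); last first.
  by apply: (@continuousM _ _ beta beta); exact: form_b_continuous.
apply: continuousB; first exact: gamma_continuous.
apply: (@continuousM _ _ (fun x => g * beta x) qq); last exact: q_continuous.
apply: (@continuousM _ _ (fun=> g) beta); first exact: cst_continuous.
exact: form_b_continuous.
Qed.

(** Openness of the sector allows a closed form proved at each of its points to be differentiated
    again. *)
Lemma near_in_sector z : sect z -> \forall x \near z, sect x.
Proof.
have gc := @gamma_continuous z; have Bc := @B_continuous z.
rewrite /in_sector; case: s => -[H1 H2].
  by apply: filterI; [exact: cvgr_gt gc _ H1 | exact: cvgr_gt Bc _ H2].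
have G0 : \forall x \near z, gam x < 0 by exact: cvgr_lt gc _ H2.
by apply: filterS G0 => x.
Qed.

Lemma eps_sqr : e ^+ 2 = 1.
Proof. by rewrite /eps; case: s; rewrite ?expr1n ?sqrrN ?expr1n. Qed.

Lemma eps_gamma_gt0 z : sect z -> 0 < e * gam z.
Proof. by rewrite /in_sector /eps; case: s => -[H1 H2]; lra. Qed.

(** Eliminating [gamma] in this way turns the later identities into rational ones in [q]. *)
Lemma q_sqr z : sect z -> gam z = e * qq z ^+ 2.
Proof.
move=> hz; rewrite /q sqr_sqrtr //; move: (eps_gamma_gt0 hz); rewrite /eps.
by case: s => H; [rewrite gtr0_norm | rewrite ltr0_norm]; lra.
Qed.

Lemma q_gt0 z : sect z -> 0 < qq z.
Proof.
move=> hz; rewrite sqrtr_gt0 normr_gt0; apply/negP => /eqP H.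
by move: (eps_gamma_gt0 hz); rewrite H mulr0 ltxx.
Qed.

Lemma is_derive_q z v : sect z -> is_derive z v qq (e * pairing z v / qq z).
Proof.
move=> hz; have := is_derive_sqrt_abs eps_sqr (eps_gamma_gt0 hz) (is_derive_gamma z v).
move=> H; apply: (is_derive_eq H); rewrite -/(q a b z); field.
by rewrite gt_eqF // q_gt0.
Qed.

Lemma h_gt0_sqr z : sect z -> 0 < hh /\ hh ^+ 2 = 1 + e * (g ^+ 2 / 4).
Proof.
move=> hz; have H : 0 < 1 + e * (g ^+ 2 / 4).
  move: hz; rewrite /in_sector /eps; case: s => -[H1 H2].
    have := sqr_ge0 g; lra.
  by move/andP: H1 => [H1 H3]; nra.
by rewrite /h sqrtr_gt0 sqr_sqrtr ?ltW.
Qed.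

Lemma B_neq0 z : sect z -> BB z != 0.
Proof.
move=> hz; have := q_sqr hz; have q0 := q_gt0 hz; move: hz.
rewrite /in_sector /eps; case: s => -[H1 H2] qE; first by rewrite gt_eqF.
move/andP: H1 => [H1 H3]; rewrite lt_eqF // /B qE.
(* Completing the square: [-B = (b + g q / 2)^2 + (1 - g^2 / 4) q^2], a sum with a positive second
   term. *)
have H4 : 0 < 1 - g ^+ 2 / 4 by nra.
have : 0 < (1 - g ^+ 2 / 4) * qq z ^+ 2 by rewrite mulr_gt0 // exprn_gt0.
have := sqr_ge0 (beta z + g / 2 * qq z).
by rewrite !expr2; lra.
Qed.

(** * The differential of the conformal factor *)

Definition p z : R := g * e / (qq z * BB z).
(** The contraction [w_i v^i]. It vanishes for [v = z], in accordance with [K] being homogeneous of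
    degree 0. *)
Definition w_form z v : R := beta z * pairing z v - gam z * beta v.

Lemma near_form_b_lt0 z : beta z < 0 -> \forall x \near z, beta x < 0.
Proof. by have bc := @form_b_continuous z; move=> H; exact: cvgr_lt bc _ H. Qed.

Lemma near_form_b_gt0 z : 0 < beta z -> \forall x \near z, 0 < beta x.
Proof. by have bc := @form_b_continuous z; move=> H; exact: cvgr_gt bc _ H. Qed.

Lemma is_derive_L z v : sect z ->
  is_derive z v (L a b g) (e * pairing z v / qq z + g / 2 * beta v).
Proof.
move=> hz; apply: is_deriveD; first exact: is_derive_q.
by apply: is_deriveZ; exact: is_derive_form_b.
Qed.

Lemma L_continuous : continuous (L a b g).
Proof.
move=> z; apply: (@continuousD _ _ _ qq); first exact: q_continuous.
apply: (@continuousM _ _ (fun=> g / 2) beta); first exact: cst_continuous.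
exact: form_b_continuous.
Qed.

Lemma is_derive_f z v : sect z -> s = SpaceLike ->
  is_derive z v (f s a b g)
    (hh * (beta z * (- pairing z v / qq z) - qq z * beta v) / - BB z).
Proof.
move=> hz sE; have [h0 h2] := h_gt0_sqr hz; have q0 := q_gt0 hz.
have eE : e = -1 by rewrite sE.
(* The derivative of [atan (L / (h b))] has denominator [(h b)^2 + L^2], which is exactly [-B]. *)
have BE : - BB z = hh ^+ 2 * beta z ^+ 2 + L a b g z ^+ 2.
  by rewrite h2 eE /B (q_sqr hz) eE /L; field.
have B0 := B_neq0 hz; rewrite BE.
have D0 : hh ^+ 2 * beta z ^+ 2 + L a b g z ^+ 2 != 0 by rewrite -BE oppr_eq0.
have dL := is_derive_L v hz; rewrite eE in dL.
have db := is_derive_form_b z v.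
have dhb : is_derive z v (fun x => hh * beta x) (hh * beta v) := is_deriveZ hh db.
have main (k : R) : beta z != 0 -> is_derive z v
    (fun x => k + atan (L a b g x / (hh * beta x)))
    (hh * (beta z * (- pairing z v / qq z) - qq z * beta v) /
      (hh ^+ 2 * beta z ^+ 2 + L a b g z ^+ 2)).
  move=> b0; have hb0 : hh * beta z != 0 by rewrite mulf_neq0 // gt_eqF.
  apply: is_derive_eq.
    apply: is_derive_cstD; apply: is_derive_atan_comp.
    by apply: is_derive_div_comp.
  have D1 : (hh * beta z) ^+ 2 * 4 + (qq z * 2 + g * beta z) ^+ 2 != 0.
    have -> : (hh * beta z) ^+ 2 * 4 + (qq z * 2 + g * beta z) ^+ 2 =
        4 * (hh ^+ 2 * beta z ^+ 2 + L a b g z ^+ 2) by rewrite /L; field.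
    by rewrite mulf_neq0 // pnatr_eq0.
  by rewrite /L; field; rewrite D1 b0 !gt_eqF.
have [b0|b0|b0] := ltgtP (beta z) 0.
- apply: near_eq_is_derive (main (- atan (G s g / 2)) _); last by rewrite lt_eqF.
  by apply: filterS (near_form_b_lt0 b0) => x bx; rewrite /f bx.
- apply: near_eq_is_derive (main (- pi - atan (G s g / 2)) _); last by rewrite gt_eqF.
  apply: filterS (near_form_b_gt0 b0) => x bx.
  by rewrite /f bx ltNge (ltW bx).
have L0 : 0 < L a b g z by rewrite /L b0 mulr0 addr0.
have Lc := @L_continuous z.
have nL : \forall x \near z, 0 < L a b g x by exact: cvgr_gt Lc _ L0.
(* The three branches of [f] glue across [b = 0], where [L > 0]. *)
apply: (@near_eq_is_derive _ _ _ (fun x => (- (pi / 2) - atan (G s g / 2))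
    + - atan (hh * beta x / L a b g x))).
  apply: filterS nL => x Lx; rewrite /f.
  have [bx|bx|->] := ltgtP (beta x) 0; last by rewrite mulr0 mul0r atan0 subr0.
    (* Inverting the argument contributes [-pi/2] for [b < 0] and [pi/2] for [b > 0]; the extra
       [-pi] in the latter branch makes both constants agree. *)
    have -> : L a b g x / (hh * beta x) = - (hh * - beta x / L a b g x)^-1.
      by field; rewrite (lt_eqF bx) (gt_eqF h0) (gt_eqF Lx).
    by rewrite atanN atanV ?divr_gt0 ?mulr_gt0 ?oppr_gt0 // mulrN mulNr atanN; ring.
  have -> : L a b g x / (hh * beta x) = (hh * beta x / L a b g x)^-1.
    by rewrite invf_div.
  by rewrite atanV ?divr_gt0 ?mulr_gt0 //; field.
apply: is_derive_eq.
  apply: is_derive_cstD; apply: is_derive_opp; apply: is_derive_atan_comp.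
  by apply: (is_derive_div_comp dhb dL); rewrite gt_eqF.
rewrite b0; move: L0; rewrite /L b0 !mulr0 addr0 => L0; field.
by rewrite !gt_eqF //= expr0n /= ?mulr0 ?add0r exprn_gt0.
Qed.

(** The product of the two factors is [B > 0] and their sum is [2 h q > 0], so both are positive. *)
Lemma time_like_factors z : sect z -> s = TimeLike ->
  0 < beta z - g_minus s g * qq z /\ 0 < g_plus s g * qq z - beta z.
Proof.
move=> hz sE; have [h0 h2] := h_gt0_sqr hz; have q0 := q_gt0 hz.
have B0 : 0 < BB z by move: hz; rewrite /in_sector sE => -[].
move: B0; rewrite /B (q_sqr hz); move: h2; rewrite /g_minus /g_plus /eps sE => h2.
set X := beta z - _; set Y := _ - beta z => B0.
have XY : 0 < X * Y.
  suff -> : X * Y = 1 * qq z ^+ 2 - g * beta z * qq z - beta z ^+ 2 by [].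
  have -> : X * Y = (hh ^+ 2 - g ^+ 2 / 4) * qq z ^+ 2
      - g * beta z * qq z - beta z ^+ 2 by rewrite /X /Y sE; field.
  by rewrite sE h2; field.
have S : 0 < X + Y.
  have -> : X + Y = 2 * h TimeLike g * qq z by rewrite /X /Y; field.
  by rewrite !mulr_gt0 // -sE.
by split; nra.
Qed.

Lemma B_factors z : sect z -> s = TimeLike ->
  BB z = (beta z - g_minus s g * qq z) * (g_plus s g * qq z - beta z).
Proof.
move=> hz sE; have [h0 h2] := h_gt0_sqr hz.
have -> : (beta z - g_minus s g * qq z) * (g_plus s g * qq z - beta z) =
  (hh ^+ 2 - g ^+ 2 / 4) * qq z ^+ 2 - g * beta z * qq z - beta z ^+ 2.
  by rewrite /g_minus /g_plus; field.
by rewrite h2 /B (q_sqr hz) sE /eps; field.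
Qed.

Lemma is_derive_conf z v : sect z ->
  is_derive z v conf (conf z * (p z * w_form z v)).
Proof.
move=> hz; have [h0 h2] := h_gt0_sqr hz; have q0 := q_gt0 hz.
have B0 := B_neq0 hz; have db := is_derive_form_b z v.
have dq := is_derive_q v hz; have gE := q_sqr hz; have nz := near_in_sector hz.
rewrite /conf; case sE : s.
  have eE : e = 1 by rewrite sE.
  have [f1 f2] := time_like_factors hz sE; have BE := B_factors hz sE.
  rewrite eE mul1r in dq; rewrite sE in f1 f2 BE h0 hz.
  have f3 : g_plus TimeLike g * qq z - beta z != 0 by rewrite gt_eqF.
  pose X x := (beta x - g_minus TimeLike g * qq x) / (g_plus TimeLike g * qq x - beta x).
  have Jx x : in_sector TimeLike a b g x ->
      J TimeLike a b g x = expR (- (G TimeLike g / 4) * ln (X x)).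
    move=> hx; have [k1 k2] : 0 < beta x - g_minus TimeLike g * qq x /\
        0 < g_plus TimeLike g * qq x - beta x.
      by rewrite -sE in hx *; exact: time_like_factors.
    (* Positivity of the base excludes the special value of [powR] at base 0, leaving the
       exponential of a logarithm. *)
    by rewrite /J /powR (gt_eqF (divr_gt0 k1 k2)).
  apply: (@near_eq_is_derive _ _ _
      (fun x => expR (- (G TimeLike g / 4) * ln (X x)) ^+ 2)).
    by apply: filterS nz => x; rewrite sE => hx; rewrite Jx.
  have dX := is_derive_div_comp
    (is_derive_sub db (is_derive_cstM (g_minus TimeLike g) dq))
    (is_derive_sub (is_derive_cstM (g_plus TimeLike g) dq) db) f3.
  apply: is_derive_eq.
    apply: is_derive_sqr_comp; apply: is_derive_expR_comp.
    apply: is_derive_cstM; apply: is_derive_ln_comp; first by rewrite divr_gt0.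
  rewrite Jx // /p /w_form BE gE eE /X /G.
  rewrite /g_plus /g_minus in f1 f2 *; field.
  by rewrite (gt_eqF q0) (gt_eqF h0) !andbT; apply/andP; split; apply: lt0r_neq0; lra.
have eE : e = -1 by rewrite sE.
have df := is_derive_f v hz sE.
have JE : J s a b g = fun x => expR (- (1 / 2) * G s g * f s a b g x).
  by rewrite /J; apply/funext => x; rewrite sE.
rewrite -sE JE.
apply: is_derive_eq.
  apply: is_derive_sqr_comp; apply: is_derive_expR_comp.
rewrite /p /w_form gE eE /G /GRing.scale /=; field.
by rewrite B0 !gt_eqF.
Qed.

Lemma conf_gt0 z : sect z -> 0 < conf z.
Proof.
move=> hz; rewrite /conf exprn_gt0 //; case sE : s; last exact: expR_gt0.
have [f1 f2] := time_like_factors hz sE; rewrite sE in f1 f2.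
by apply: powR_gt0; exact: divr_gt0.
Qed.

(** * The covector [y_i] and the metric tensor *)

Lemma eps_cases : e = 1 \/ e = -1.
Proof. by rewrite /eps; case: s; [left|right]. Qed.

(* [y_i / K]. *)
Definition l_low z i : R := u_low z i - (beta z + g * qq z) * b 0 i.

Lemma is_derive_B z v : sect z ->
  is_derive z v BB (2 * pairing z v
    - (g * beta v * qq z + g * beta z * (e * pairing z v / qq z))
    - 2 * beta z * beta v).
Proof.
move=> hz; apply: is_derive_sub; last first.
  by apply: is_derive_sqr_comp; exact: is_derive_form_b.
apply: is_derive_sub; first exact: is_derive_gamma.
apply: is_derive_mul_comp; last exact: is_derive_q.
by apply: is_derive_cstM; exact: is_derive_form_b.
Qed.

Lemma is_derive_F2 z v : sect z ->
  is_derive z v (F2 s a b g)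
    (2 * conf z * (pairing z v - (beta z + g * qq z) * beta v)).
Proof.
move=> hz; have := is_derive_mul_comp (is_derive_B v hz) (is_derive_conf v hz).
move=> H; apply: (is_derive_eq H).
(* In [dB + B p w] the factor [B] cancels against [p], and the terms in [g b / q] cancel each
   other. *)
have q0 := q_gt0 hz; have B0 := B_neq0 hz.
rewrite /p /w_form (q_sqr hz).
by case: eps_cases => ->; field; rewrite B0 gt_eqF.
Qed.

Lemma partial_F2 z i : sect z -> partial i (F2 s a b g) z = 2 * conf z * l_low z i.
Proof.
move=> hz; rewrite /partial (is_derive_val (is_derive_F2 (delta_mx 0 i) hz)).
by rewrite pairing_delta form_b_delta.
Qed.

Lemma y_lowE z i : sect z -> y_low s a b g z i = conf z * l_low z i.
Proof. by move=> hz; rewrite /y_low partial_F2 //; field. Qed.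

Lemma is_derive_l_low z v i : sect z ->
  is_derive z v (l_low^~ i)
    (u_low v i - (beta v + g * (e * pairing z v / qq z)) * b 0 i).
Proof.
move=> hz; apply: is_derive_sub; first exact: is_derive_u_low.
rewrite (_ : (fun x => _) = (fun x => b 0 i * (beta x + g * qq x))); last first.
  by apply/funext => x; rewrite mulrC.
rewrite mulrC; apply: is_derive_cstM; apply: is_derive_add.
  exact: is_derive_form_b.
by apply: is_derive_cstM; exact: is_derive_q.
Qed.

(** The difference [r_ij - b_i b_j] is [a_ij], written with [r] because differentiating [u_i]
    produces [r_ij]. *)
Definition metric z i j : R :=
  conf z * (r i j - b 0 i * b 0 j + p z * (beta z * u_low z i * u_low z j
    - gam z * (u_low z i * b 0 j + u_low z j * b 0 i)
    + gam z * (beta z + g * qq z) * b 0 i * b 0 j)).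

Lemma g_lowE z i j : sect z -> g_low s a b g z i j = metric z i j.
Proof.
move=> hz; rewrite mxE /partial.
have E : \forall x \near z,
    2 * (conf x * l_low x j) = 'D_(delta_mx 0 j) (F2 s a b g) x.
  apply: filterS (near_in_sector hz) => x hx.
  by rewrite -/(partial j _ x) partial_F2 // mulrA.
have D := is_derive_cstM 2 (is_derive_mul_comp
  (is_derive_conf (delta_mx 0 i) hz) (is_derive_l_low (delta_mx 0 i) j hz)).
rewrite (is_derive_val (near_eq_is_derive E D)).
rewrite /metric /p /w_form /l_low pairing_delta form_b_delta u_low_delta (tensor_rC j i).
have q0 := q_gt0 hz; have B0 := B_neq0 hz.
move: B0; rewrite /B (q_sqr hz) => B0.
(* The relation [eps^2 = 1] is supplied to [field] by treating both values of [eps]. *)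
by case: eps_cases B0 => ->; rewrite ?mul1r => B0; field; rewrite B0 (gt_eqF q0).
Qed.

(** * The Cartan tensor in terms of [w_i] *)

Definition w_low z i : R := beta z * u_low z i - gam z * b 0 i.

Lemma w_form_delta z i : w_form z (delta_mx 0 i) = w_low z i.
Proof. by rewrite /w_form pairing_delta form_b_delta. Qed.

Lemma is_derive_p z v : sect z ->
  is_derive z v p (- (g * e) * ((e * pairing z v / qq z) * BB z + qq z *
     (2 * pairing z v
    - (g * beta v * qq z + g * beta z * (e * pairing z v / qq z))
    - 2 * beta z * beta v)) / (qq z * BB z) ^+ 2).
Proof.
move=> hz; have q0 := q_gt0 hz; have B0 := B_neq0 hz.
have D := is_derive_mul_comp (is_derive_q v hz) (is_derive_B v hz).
have n0 : qq z * BB z != 0 by rewrite mulf_neq0 // gt_eqF.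
have := is_derive_cstM (g * e) (is_derive_inv_comp D n0) => H.
by apply: (is_derive_eq H); field; rewrite B0 gt_eqF.
Qed.

(** The bare product rule, with its value left unsimplified for [cartanE]; [metric / conf] stands
    for the bracket in [metric]. *)
Lemma is_derive_metric z v i j : sect z ->
  is_derive z v (fun x => metric x i j)
   (conf z * (p z * w_form z v) * (metric z i j / conf z) + conf z *
    (- (g * e) * ((e * pairing z v / qq z) * BB z + qq z *
     (2 * pairing z v
    - (g * beta v * qq z + g * beta z * (e * pairing z v / qq z))
    - 2 * beta z * beta v)) / (qq z * BB z) ^+ 2 *
     (beta z * u_low z i * u_low z j
    - gam z * (u_low z i * b 0 j + u_low z j * b 0 i)
    + gam z * (beta z + g * qq z) * b 0 i * b 0 j)
    + p z * (beta v * u_low z i * u_low z j + beta z * u_low v i * u_low z j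
       + beta z * u_low z i * u_low v j
       - 2 * pairing z v * (u_low z i * b 0 j + u_low z j * b 0 i)
       - gam z * (u_low v i * b 0 j + u_low v j * b 0 i)
       + 2 * pairing z v * (beta z + g * qq z) * b 0 i * b 0 j
       + gam z * (beta v + g * (e * pairing z v / qq z)) * b 0 i * b 0 j))).
Proof.
move=> hz; have K0 := conf_gt0 hz.
have dbeta := is_derive_form_b z v; have dg := is_derive_gamma z v.
have dq := is_derive_q v hz.
have du k := is_derive_u_low z v k.
have dub k l : is_derive z v (fun x => u_low x k * b 0 l) (b 0 l * u_low v k).
  rewrite (_ : (fun x => _) = (fun x => b 0 l * u_low x k)); last first.
    by apply/funext => x; rewrite mulrC.
  exact: is_derive_cstM.
have dbq : is_derive z v (fun x => beta x + g * qq x)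
    (beta v + g * (e * pairing z v / qq z)).
  exact: is_derive_add dbeta (is_derive_cstM g dq).
have d1 := is_derive_mul_comp (is_derive_mul_comp dbeta (du i)) (du j).
have d2 := is_derive_mul_comp dg (is_derive_add (dub i j) (dub j i)).
have d3 := is_derive_cstM (b 0 i * b 0 j) (is_derive_mul_comp dg dbq).
have d4 := is_derive_add (is_derive_sub d1 d2) d3.
have d5 := is_derive_mul_comp (is_derive_conf v hz)
  (is_derive_cstD (r i j - b 0 i * b 0 j) (is_derive_mul_comp (is_derive_p v hz) d4)).
rewrite (_ : (fun x => metric x i j) = (fun x => conf x * (r i j - b 0 i * b 0 j +
   p x * ((beta x * u_low x i * u_low x j
    - gam x * (u_low x i * b 0 j + u_low x j * b 0 i))
    + b 0 i * b 0 j * (gam x * (beta x + g * qq x)))))); last first.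
  by apply/funext => x; rewrite /metric; ring.
apply: (is_derive_eq d5).
have q0 := q_gt0 hz; have B0 := B_neq0 hz.
rewrite /metric; cbv beta.
by field; rewrite B0 (gt_eqF q0) gt_eqF.
Qed.

Lemma cartan_derive z i j k : sect z ->
  cartan s a b g z i j k = 1 / 2 * 'D_(delta_mx 0 k) (fun x => metric x i j) z.
Proof.
move=> hz; rewrite /cartan /partial; congr (_ * _); apply: near_eq_derive.
by apply: filterS (near_in_sector hz) => x hx; rewrite g_lowE.
Qed.

Lemma h_lowE z i j : sect z ->
  h_low s a b g z i j = metric z i j - conf z / BB z * l_low z i * l_low z j.
Proof.
move=> hz; rewrite /h_low g_lowE // !y_lowE // /F2 -/(conf z).
by field; rewrite (B_neq0 hz) gt_eqF ?conf_gt0.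
Qed.

(** Once closed forms are inserted, both sides are rational in [q], [b], [u_i], [b_i], [r_ij] and
    [K]. The angular metric absorbs everything except a multiple of [w_i w_j w_k]. *)
Lemma cartanE z i j k : sect z -> cartan s a b g z i j k =
  p z / 2 * (w_low z i * h_low s a b g z j k + w_low z j * h_low s a b g z i k
    + w_low z k * h_low s a b g z i j)
  + p z / 2 * (e * conf z / (qq z ^+ 2 * BB z)) * (w_low z i * w_low z j * w_low z k).
Proof.
move=> hz; rewrite cartan_derive // (is_derive_val (is_derive_metric _ _ _ hz)).
rewrite !h_lowE // /metric w_form_delta /p pairing_delta form_b_delta !u_low_delta.
rewrite /l_low /w_low.
have q0 := q_gt0 hz; have B0 := B_neq0 hz; have K0 := conf_gt0 hz.
move: B0; rewrite /B (q_sqr hz) => B0.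
by case: eps_cases B0 => ->; rewrite ?mul1r => B0; field;
  rewrite B0 (gt_eqF q0) (gt_eqF K0).
Qed.

(** * Raising indices with [a], and the determinant of the metric *)

Variable c : R.
Hypothesis a_unit : a \in unitmx.
Hypothesis b_norm : \sum_i \sum_j (invmx a) i j * b 0 i * b 0 j = - c ^+ 2.

Local Notation m := (1 - c ^+ 2).
Local Notation nn := (nu s a b g c).

Definition b_sharp : 'cV[R]_N := invmx a *m b^T.
Definition u_row z : 'rV[R]_N := \row_i u_low z i.

Lemma a_mul_b_sharp : a *m b_sharp = b^T.
Proof. by rewrite /b_sharp mulmxA mulmxV // mul1mx. Qed.

Lemma u_rowE z : u_row z = z *m a + beta z *: b.
Proof.
apply/rowP => i; rewrite !mxE /u_low /form_b mulr_suml -big_split /=.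
apply: eq_bigr => j _; rewrite [r i j]mxE -{1}a_sym mxE; ring.
Qed.

(** Presents [u] as an image under [a], the form required by [det_add_rank2]. *)
Lemma a_mul_u_sharp z : a *m (z^T + beta z *: b_sharp) = (u_row z)^T.
Proof.
rewrite mulmxDr -scalemxAr a_mul_b_sharp u_rowE linearD linearZ /=.
by rewrite trmx_mul a_sym.
Qed.

Lemma dot_linl (k1 k2 : R) (x t : 'rV[R]_N) (v : 'cV[R]_N) :
  ((k1 *: x + k2 *: t) *m v) 0 0 = k1 * (x *m v) 0 0 + k2 * (t *m v) 0 0.
Proof.
by rewrite mulmxDl -!scalemxAl mxE [(k1 *: (x *m v)) 0 0]mxE [(k2 *: (t *m v)) 0 0]mxE.
Qed.

Lemma dot_linr (x : 'rV[R]_N) (k : R) (v t : 'cV[R]_N) :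
  (x *m (v + k *: t)) 0 0 = (x *m v) 0 0 + k * (x *m t) 0 0.
Proof. by rewrite mulmxDr -scalemxAr mxE [(k *: (x *m t)) 0 0]mxE. Qed.

Lemma dot_b_sharp : (b *m b_sharp) 0 0 = - c ^+ 2.
Proof.
rewrite -b_norm mxE; apply: eq_bigr => i _; rewrite [b_sharp i 0]mxE mulr_sumr.
by apply: eq_bigr => j _; rewrite mxE; ring.
Qed.

Lemma dot_b_tr z : (b *m z^T) 0 0 = beta z.
Proof. by rewrite mxE; apply: eq_bigr => i _; rewrite mxE. Qed.

Lemma dot_u_tr z : (u_row z *m z^T) 0 0 = gam z.
Proof. by rewrite gammaE mxE; apply: eq_bigr => i _; rewrite !mxE. Qed.

(** From [u_i = a_ij y^j + b b_i]: the first term contracts with [b^i] to [b], the second to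
    [-c^2 b]. *)
Lemma dot_u_b_sharp z : (u_row z *m b_sharp) 0 0 = m * beta z.
Proof.
rewrite u_rowE -[z *m a]scale1r dot_linl -mulmxA a_mul_b_sharp dot_b_sharp.
have -> : (z *m b^T) 0 0 = beta z.
  have E : b *m z^T = (z *m b^T)^T by rewrite trmx_mul trmxK.
  by rewrite -dot_b_tr E [RHS]mxE.
by ring.
Qed.

(** The rows [s1], [s2] write the rank-two part of [metric / K] as [u_i s1_j + b_i s2_j]. *)
Definition s1_row z : 'rV[R]_N := (p z * beta z) *: u_row z + (- (p z * gam z)) *: b.
Definition s2_row z : 'rV[R]_N :=
  (- (p z * gam z)) *: u_row z + (p z * (gam z * (beta z + g * qq z))) *: b.

Lemma g_low_mxE z : sect z -> g_low s a b g z = conf z *: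
  (a + (a *m (z^T + beta z *: b_sharp) *m s1_row z + a *m b_sharp *m s2_row z)).
Proof.
move=> hz; rewrite a_mul_u_sharp a_mul_b_sharp; apply/matrixP => i j.
rewrite g_lowE // /metric.
have outer (x : 'cV[R]_N) (t : 'rV[R]_N) : (x *m t) i j = x i 0 * t 0 j.
  by rewrite mxE big_ord1.
rewrite [RHS]mxE [in RHS]mxE [X in _ = _ * (_ + X)]mxE !outer [r i j]mxE !mxE.
ring.
Qed.

Lemma det_g_low z : sect z ->
  \det (g_low s a b g z) = conf z ^+ N * \det a * (nn z / qq z).
Proof.
move=> hz; rewrite g_low_mxE // detZ det_add_rank2 -mulrA; congr (_ * (_ * _)).
rewrite /s1_row /s2_row !dot_linl !dot_linr dot_u_tr dot_u_b_sharp dot_b_sharp dot_b_tr.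
have q0 := q_gt0 hz; have B0 := B_neq0 hz.
rewrite /p /nu; move: B0; rewrite /B (q_sqr hz) => B0.
by case: eps_cases B0 => ->; rewrite ?mul1r => B0; field; rewrite B0 (gt_eqF q0).
Qed.

Lemma det_g_low_neq0 z : sect z -> nn z != 0 -> \det (g_low s a b g z) != 0.
Proof.
move=> hz n0; rewrite det_g_low // !mulf_neq0 ?invr_eq0 //.
- by rewrite expf_neq0 // gt_eqF // conf_gt0.
- by move: a_unit; rewrite unitmxE unitfE.
- by rewrite gt_eqF // q_gt0.
Qed.

(** * The vector [C_i], its contravariant form and its square *)

(** The ratio of [C_i] to [w_i]; its second factor is the [1 / X] of the theorem. *)
Definition kappa z : R := p z / 2 * (N%:R + e * (m * BB z / (qq z * nn z))).

(** The power [K ^ N] contributes [N p w / 2]. As [nu / q = 1 - eps (1 - c^2) g b / q] and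
    [d (b / q) = - eps w / q^3], the other factor also contributes a multiple of [w]. *)
Lemma C_lowE z i : sect z -> nn z != 0 -> C_low s a b g z i = kappa z * w_low z i.
Proof.
move=> hz n0; have q0 := q_gt0 hz; have B0 := B_neq0 hz; have K0 := conf_gt0 hz.
pose F x := conf x ^+ N * \det a * (nn x / qq x).
have da : \det a != 0 by move: a_unit; rewrite unitmxE unitfE.
have E : \forall x \near z, ln (Num.sqrt `|F x|) =
    ln (Num.sqrt `|\det (g_low s a b g x)|).
  by apply: filterS (near_in_sector hz) => x hx; rewrite det_g_low.
pose v : 'rV[R]_N := delta_mx 0 i.
have K1 : conf z != 0 by rewrite gt_eqF.
have q1 : qq z != 0 by rewrite gt_eqF.
have dn : is_derive z v nn (e * pairing z v / qq z - e * m * g * beta v).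
  apply: is_derive_sub; first exact: is_derive_q.
  exact: is_derive_cstM (is_derive_form_b z v).
have dF := is_derive_mul_comp
  (is_derive_mul_comp (is_derive_pow_comp N (is_derive_conf v hz) K1)
     (is_derive_cst (\det a) z v))
  (is_derive_div_comp dn (is_derive_q v hz) q1).
have F0 : F z != 0.
  apply: mulf_neq0; first by apply: mulf_neq0 => //; exact: expf_neq0.
  by apply: mulf_neq0; rewrite ?invr_eq0.
have D := is_derive_ln_sqrt_abs dF F0.
rewrite /C_low /partial (is_derive_val (near_eq_is_derive E D)) -w_form_delta -/v.
have KN : conf z ^+ N != 0 by rewrite expf_neq0.
rewrite /kappa; set kn := conf z ^+ N in KN F0 *.
rewrite /F -/kn /w_form /p (q_sqr hz).
move: n0; rewrite /nu => n0.
by case: eps_cases n0 => ->; rewrite ?mul1r => n0; field; rewrite n0 q1 B0 KN K1 /cst da.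
Qed.

(* The contravariant components [w^i = g^ij w_j]. *)
Definition w_sharp z : 'cV[R]_N :=
  (- (qq z * BB z / (conf z * nn z))) *: b_sharp +
  (qq z * (beta z + g * qq z * c ^+ 2) / (conf z * nn z)) *: z^T.

Lemma mulmx_linr n (A : 'M[R]_(n, N)) (k1 k2 : R) (v t : 'cV[R]_N) i :
  (A *m (k1 *: v + k2 *: t)) i 0 = k1 * (A *m v) i 0 + k2 * (A *m t) i 0.
Proof.
by rewrite mulmxDr -!scalemxAr mxE [(k1 *: (A *m v)) i 0]mxE [(k2 *: (A *m t)) i 0]mxE.
Qed.

(** Since [a] sends [b^i] to [b_i] and [y^i] to [u_i - b b_i], the metric maps the span of [b^i],
    [y^i] into that of [b_i], [u_i]. Comparing coefficients there gives those of [w_sharp]. *)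
Lemma g_low_w_sharp z i : sect z -> nn z != 0 ->
  (g_low s a b g z *m w_sharp z) i 0 = w_low z i.
Proof.
move=> hz n0; have q0 := q_gt0 hz; have B0 := B_neq0 hz; have K0 := conf_gt0 hz.
have outer (x : 'cV[R]_N) (t : 'rV[R]_N) (v : 'cV[R]_N) :
    ((x *m t) *m v) i 0 = x i 0 * (t *m v) 0 0.
  by rewrite -mulmxA [LHS]mxE big_ord1.
have uE : (u_row z)^T i 0 = u_low z i by rewrite !mxE.
have bE : b^T i 0 = b 0 i by rewrite mxE.
have az : (a *m z^T) i 0 = u_low z i - beta z * b 0 i.
  have -> : a *m z^T = (u_row z - beta z *: b)^T.
    by rewrite u_rowE addrK trmx_mul a_sym.
  by rewrite !mxE.
have gv (v : 'cV[R]_N) : (g_low s a b g z *m v) i 0 = conf z * ((a *m v) i 0 +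
    (u_low z i * (s1_row z *m v) 0 0 + b 0 i * (s2_row z *m v) 0 0)).
  rewrite g_low_mxE // a_mul_u_sharp a_mul_b_sharp -scalemxAl mxE; congr (_ * _).
  by rewrite mulmxDl mulmxDl mxE [X in _ + X = _]mxE !outer uE bE.
rewrite /w_sharp mulmx_linr !gv a_mul_b_sharp az /s1_row /s2_row !dot_linl.
rewrite dot_u_tr dot_u_b_sharp dot_b_sharp dot_b_tr bE /w_low /p.
move: B0 n0; rewrite /B /nu (q_sqr hz) => B0 n0.
by case: eps_cases B0 n0 => ->; rewrite ?mul1r => B0 n0; field;
  rewrite B0 n0 (gt_eqF q0) (gt_eqF K0).
Qed.

Lemma dot_w_w_sharp z : sect z -> nn z != 0 -> \sum_i w_low z i * w_sharp z i 0 =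
  - (qq z * BB z * (m * beta z ^+ 2 + gam z * c ^+ 2)) / (conf z * nn z).
Proof.
move=> hz n0; have K0 := conf_gt0 hz.
have -> : \sum_i w_low z i * w_sharp z i 0 =
    ((beta z *: u_row z + (- gam z) *: b) *m w_sharp z) 0 0.
  by rewrite [RHS]mxE; apply: eq_bigr => i _; congr (_ * _); rewrite !mxE mulNr.
rewrite /w_sharp mulmx_linr !dot_linl dot_u_tr dot_u_b_sharp dot_b_sharp dot_b_tr.
by field; rewrite n0 gt_eqF.
Qed.

(** The condition [nu <> 0] makes the metric invertible, so its inverse can be applied to
    [g_ij w^j = w_i]. *)
Lemma C_upE z i : sect z -> nn z != 0 ->
  C_up s a b g z i = kappa z * w_sharp z i 0.
Proof.
move=> hz n0; have gu : g_low s a b g z \in unitmx.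
  by rewrite unitmxE unitfE det_g_low_neq0.
have -> : C_up s a b g z i =
    (g_up s a b g z *m (kappa z *: (g_low s a b g z *m w_sharp z))) i 0.
  rewrite [RHS]mxE; apply: eq_bigr => j _; congr (_ * _).
  by rewrite mxE g_low_w_sharp // C_lowE.
by rewrite -scalemxAr mulKmx // mxE.
Qed.

Lemma C_sqE z : sect z -> nn z != 0 -> C_sq s a b g z = kappa z ^+ 2 *
  (- (qq z * BB z * (m * beta z ^+ 2 + gam z * c ^+ 2)) / (conf z * nn z)).
Proof.
move=> hz n0; rewrite -dot_w_w_sharp // mulr_sumr; apply: eq_bigr => i _.
by rewrite C_upE // C_lowE //; ring.
Qed.

(** * Replacing [w] by [C] in the Cartan tensor *)

Lemma cartan_decomposition z : sect z -> nn z != 0 -> C_sq s a b g z != 0 ->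
  exists X : R,
    [/\ X != 0,
        1 / X = N%:R + e * (m * BB z / (qq z * nn z))
      & forall i j k : 'I_N,
          let C := C_low s a b g z in
          let h := h_low s a b g z in
          cartan s a b g z i j k =
          X * (C i * h j k + C j * h i k + C k * h i j
               - (N%:R + 1 - 1 / X) * (1 / C_sq s a b g z)
                 * (C i * C j * C k))].
Proof.
move=> hz n0 C0; have q0 := q_gt0 hz; have B0 := B_neq0 hz; have K0 := conf_gt0 hz.
(* [C_h C^h = kappa^2 w_h w^h], so its nonvanishing yields nonzero [p], [w_h w^h] and [T]; the last
   makes [X = 1 / T] meaningful. *)
move: C0; rewrite C_sqE // mulf_eq0 expf_eq0 /= negb_or => /andP[k0 W0].
set T := N%:R + e * (m * BB z / (qq z * nn z)).
have T0 : T != 0 by move: k0; rewrite /kappa mulf_eq0 negb_or => /andP[].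
have p0 : p z != 0.
  by move: k0; rewrite /kappa !mulf_eq0 !negb_or => /andP[/andP[]].
have D0 : m * beta z ^+ 2 + gam z * c ^+ 2 != 0.
  by apply: contraNneq W0 => ->; rewrite mulr0 oppr0 mul0r.
(* In [eps (1 - c^2) B - q nu] the terms with [g] cancel, leaving the quadratic expression that also
   occurs in [w_h w^h]. *)
have key : T - N%:R - 1 =
    - e * (m * beta z ^+ 2 + gam z * c ^+ 2) / (qq z * nn z).
  rewrite /T /B /nu (q_sqr hz); move: n0; rewrite /nu => n0.
  by case: eps_cases => ee; rewrite ee ?mul1r in n0 *; field; rewrite n0 (gt_eqF q0).
set W := - _ / _ in W0.
(* Thus the coefficient of the cubic term in [cartanE] is expressed through [1 / X] and [w_h w^h]
   alone. *)
have DW : e * conf z / (qq z ^+ 2 * BB z) = (T - N%:R - 1) / W.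
  by rewrite key /W; field; rewrite D0 B0 n0 (gt_eqF q0) (gt_eqF K0).
exists T^-1; split; [by rewrite invr_eq0 | by rewrite div1r invrK |].
move=> i j k /=; rewrite cartanE // !C_lowE // /kappa -/T -/W div1r invrK DW.
move: (w_low z i) (w_low z j) (w_low z k) => wi wj wk.
move: (h_low _ _ _ _ _ j k) (h_low _ _ _ _ _ i k) (h_low _ _ _ _ _ i j) => hjk hik hij.
move: (p z) p0 (T) T0 (W) W0 => pz p0 t t0 w w0.
by field; rewrite p0 t0 w0.
Qed.

End CartanTensor.

(** * Algebraic consequences of the signature, and the conclusion *)

Lemma signature_sym (R : realType) (N : nat) (a : 'M[R]_N) :
  has_signature_1_minus a -> a^T = a.
Proof. by case=> P _ ->; rewrite !trmx_mul trmxK tr_diag_mx mulmxA. Qed.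

Lemma signature_unitmx (R : realType) (N : nat) (a : 'M[R]_N) :
  has_signature_1_minus a -> a \in unitmx.
Proof.
case=> P Pu ->; rewrite !unitmx_mul unitmx_tr Pu andbT /=.
rewrite unitmxE det_diag unitfE; apply/prodf_neq0 => i _; rewrite mxE.
by case: ifP; rewrite ?oppr_eq0 oner_neq0.
Qed.

Unset Implicit Arguments.

(* M is the set of points of the manifold; a x, b x, c x, g x are the
   components of the fields at x in a local chart. Nothing is differentiated
   in x, so no further structure on M is used. *)
Theorem mainTheorem5 (R : realType) (N : nat) (M : Type)
  (a : M -> 'M[R]_N) (b : M -> 'rV[R]_N) (c g : M -> R)
  (ha : forall x : M, has_signature_1_minus (a x))
  (hb : forall x : M,
      \sum_i \sum_j (invmx (a x)) i j * b x 0 i * b x 0 j = - c x ^+ 2)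
  (hc : forall x : M, 0 < c x <= 1)
  (s : sector) (x : M) (y : 'rV[R]_N)
  (hy : in_sector s (a x) (b x) (g x) y)
  (hnu : nu s (a x) (b x) (g x) (c x) y != 0)
  (hC : C_sq s (a x) (b x) (g x) y != 0) :
  exists X : R,
    [/\ X != 0,
        1 / X = N%:R + eps R s * ((1 - c x ^+ 2) * B (a x) (b x) (g x) y
                  / (q (a x) (b x) y * nu s (a x) (b x) (g x) (c x) y))
      & forall i j k : 'I_N,
          let C := C_low s (a x) (b x) (g x) y in
          let h := h_low s (a x) (b x) (g x) y in
          cartan s (a x) (b x) (g x) y i j k =
          X * (C i * h j k + C j * h i k + C k * h i j
               - (N%:R + 1 - 1 / X) * (1 / C_sq s (a x) (b x) (g x) y)
                 * (C i * C j * C k))].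
Proof.
exact: (cartan_decomposition (signature_sym (ha x)) (signature_unitmx (ha x)) (hb x)).
Qed.
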